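(* Let $k>1$, $n\ge 1$ and $m\ge 0$ be integers with $C_k(n,m)>0$. If $\pi$ is chosen uniformly at random among permutations in $S_n$ with exactly $m$ $k$-cycles, then \[ \mathbb{E}[\pi(1)\mid \pi\in S_n\text{ has exactly } m\ k\text{-cycles}]=\frac n2\left(1-\frac{C_k(n-1,m)}{C_k(n,m)}\right)+1. \]
   Context: A $k$-cycle of a permutation is a cycle of length exactly $k$ in its disjoint cycle decomposition. $C_k(n,m)$ denotes the number of permutations in $S_n$ with exactly $m$ $k$-cycles, with $S_0$ consisting of the single empty permutation (which has no cycles). *)

(* Defs.v *)
From mathcomp Require Import all_boot all_order all_fingroup all_algebra.

Set Implicit Arguments.
Unset Strict Implicit.
Unset Printing Implicit Defensive.

Import GRing.Theory Num.Theory.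

(* [porbits s] contains the fixed points of [s] as singletons, so that it is
   the full disjoint cycle decomposition of [s], 1-cycles included. *)
Definition num_cycles (n k : nat) (s : 'S_n) : nat :=
  #|[set c in porbits s | #|c| == k]|.

Definition perms_with (k n m : nat) : {set 'S_n} :=
  [set s : 'S_n | num_cycles k s == m].

Definition C (k n m : nat) : nat := #|perms_with k n m|.

Local Open Scope ring_scope.

Definition uniform_mass (R : realFieldType) (T : finType) (A : {set T}) (x : T)
  : R := if x \in A then #|A|%:R^-1 else 0.

Definition expectation (R : realFieldType) (T : finType) (p : T -> R)
  (X : T -> R) : R := \sum_(x : T) p x * X x.

(* The points permuted by 'S_n are 0, ..., n-1 in the library and 1, ..., n in
   the usual convention: the point 1 is the ordinal 0, and values are shifted
   back by one. *)
Definition value_at_1 (n : nat) (n_gt0 : (0 < n)%N) (s : 'S_n) : nat :=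
  (s (Ordinal n_gt0)).+1.

(* Main.v *)
(* Split the permutations with m k-cycles according to whether 0 is fixed. As
   k > 1, deleting the fixed point 0 leaves a permutation of n - 1 points with
   the same k-cycles, so C(n - 1, m) of them fix 0. The other C(n, m) - C(n - 1, m)
   ones are permuted by conjugation with the reversal of the points other than
   0, so the average image of 0 over them is n / 2. *)
Require Import Defs.
From mathcomp Require Import all_boot all_order all_fingroup all_algebra.
From mathcomp Require Import ring.

Set Implicit Arguments.
Unset Strict Implicit.
Unset Printing Implicit Defensive.

Import GRing.Theory Num.Theory.

Section Intertwining.

Variables (T U : finType) (f : T -> U) (s : {perm T}) (u : {perm U}).
Hypotheses (f_inj : injective f) (fsu : forall x, f (s x) = u (f x)).

Lemma porbit_intertwine x : porbit u (f x) = f @: porbit s x.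
Proof.
have fsuX i y : f ((s ^+ i)%g y) = (u ^+ i)%g (f y).
  by elim: i => [|i IHi]; rewrite ?expg0 ?perm1 // !expgSr !permM fsu IHi.
apply/setP=> y; apply/porbitP/imsetP => [[i ->]|[z /porbitP[i ->] ->]].
  by exists ((s ^+ i)%g x); rewrite ?mem_porbit.
by exists i.
Qed.

(** Taking images under the injective [f] preserves cardinality and is injective on sets, and it
    carries each cycle of [s] to a cycle of [u]. This serves both conjugation and the insertion of a
    fixed point. *)
Lemma card_cycles_intertwine k :
  #|[set c in porbits s | #|c| == k]|
  = #|[set c in [set porbit u (f x) | x : T] | #|c| == k]|.
Proof.
rewrite -(card_imset _ (imset_inj f_inj)); apply: eq_card => c.
rewrite !inE; apply/imsetP/andP => [[d] | [/imsetP[x _ ->]]].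
  rewrite inE => /andP[/imsetP[x _ ->] cardk] ->.
  split; last by rewrite card_imset.
  by apply/imsetP; exists x; rewrite ?porbit_intertwine.
rewrite porbit_intertwine card_imset // => cardk.
by exists (porbit s x); rewrite // inE cardk imset_f.
Qed.

End Intertwining.

Lemma num_cyclesJ n k (s t : 'S_n) : num_cycles k (s ^ t)%g = num_cycles k s.
Proof.
have ts x : t (s x) = (s ^ t)%g (t x) by rewrite permJ.
rewrite /num_cycles (card_cycles_intertwine (@perm_inj _ t) ts).
apply: eq_card => c; rewrite !inE; congr (_ && _).
apply/imsetP/imsetP => -[x _ ->]; last by exists (t x).
by exists (t^-1 x)%g; rewrite ?permKV.
Qed.

(** The only cycle of the lifted permutation missed by [lift ord0] is the singleton of 0, whose
    length 1 differs from [k]. *)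
Lemma num_cycles_lift n k (s : 'S_n) :
  1 < k -> num_cycles k (lift_perm ord0 ord0 s) = num_cycles k s.
Proof.
move=> k_gt1; set u := lift_perm _ _ s.
have ls x : lift ord0 (s x) = u (lift ord0 x) by rewrite lift_perm_lift.
rewrite /num_cycles (card_cycles_intertwine (@lift_inj _ ord0) ls).
have u0 : #|porbit u ord0| = 1.
  rewrite (_ : porbit u ord0 = [set ord0]) ?cards1 //.
  apply/setP=> y; rewrite inE; apply/porbitP/eqP => [[i ->]|->].
    by rewrite permX_fix // lift_perm_id.
  by exists 0; rewrite perm1.
apply: eq_card => c; rewrite !inE.
apply/andP/andP => -[/imsetP[x _ ->] cardk]; split => //; last exact: imset_f.
case: (unliftP ord0 x) cardk => [y -> _|-> /eqP]; first exact: imset_f.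
by rewrite u0 => kE; rewrite -kE in k_gt1.
Qed.

Lemma lift_perm0_inj n : injective (@lift_perm n ord0 ord0).
Proof.
move=> s t st; apply/permP => x; apply: (@lift_inj _ ord0).
by rewrite -!(lift_perm_lift ord0 ord0) st.
Qed.

(** One inclusion and equal cardinalities suffice: fixing 0 means being supported off 0, which
    leaves n! permutations. *)
Lemma imset_lift_perm0 n :
  @lift_perm n ord0 ord0 @: setT = [set s : 'S_n.+1 | s ord0 == ord0].
Proof.
apply/eqP; rewrite eqEcard card_imset; last exact: lift_perm0_inj.
apply/andP; split.
  by apply/subsetP=> _ /imsetP[s _ ->]; rewrite inE lift_perm_id.
have -> : [set s : 'S_n.+1 | s ord0 == ord0] = [set s | perm_on [set~ ord0] s].
  apply/setP=> s; rewrite !inE; apply/eqP/subsetP => [s0 x|sP].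
    by rewrite !inE; apply: contraNneq => ->; rewrite s0.
  by apply/eqP/negPn/negP => /(sP ord0); rewrite !inE eqxx.
by rewrite cardsE card_perm cardsT card_Sn cardsC1 card_ord.
Qed.

Lemma card_perms_with_fix0 k n m :
  1 < k -> #|[set s in perms_with k n.+1 m | s ord0 == ord0]| = C k n m.
Proof.
move=> k_gt1; rewrite /C -(card_imset _ (@lift_perm0_inj n)).
apply: eq_card => s; rewrite !inE.
apply/andP/imsetP => [[sm s0]|[t tm ->]]; last first.
  by rewrite lift_perm_id num_cycles_lift // eqxx; rewrite inE in tm.
have /imsetP[t _ st] : s \in @lift_perm n ord0 ord0 @: setT.
  by rewrite imset_lift_perm0 inE.
by exists t => //; rewrite inE -(num_cycles_lift t k_gt1) -st.
Qed.

(* Conjugation by the involution fixing 0 and sending i > 0 to n + 1 - i pairs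
   the values [s 0] and [n + 1 - s 0]. *)
Lemma sum_perms_with_moved k n m :
  (\sum_(s in perms_with k n.+1 m) (s ord0 : nat)).*2
  = n.+1 * #|[set s in perms_with k n.+1 m | s ord0 != ord0]|.
Proof.
set A := perms_with _ _ _.
pose r : 'S_n.+1 := lift_perm ord0 ord0 (perm (@rev_ord_inj n)).
have r0 : r ord0 = ord0 by rewrite lift_perm_id.
have sumJ : \sum_(s in A) (s ord0 : nat) = \sum_(s in A) (r (s ord0) : nat).
  rewrite (reindex_inj (conjg_inj r)) /=; apply: eq_big => s.
    by rewrite !inE num_cyclesJ.
  (* As [r] fixes 0, the conjugate [s ^ r] sends 0 = r(0) to r(s(0)). *)
  by rewrite -[in LHS]r0 permJ.
rewrite -addnn {2}sumJ -big_split /= mulnC -sum_nat_const.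
rewrite (bigID (fun s : 'S_n.+1 => s ord0 == ord0)) /= big1 => [|s]; last first.
  by case/andP=> _ /eqP->; rewrite r0.
rewrite add0n; apply: eq_big => s; first by rewrite !inE.
(* If s(0) = j + 1, then r(s(0)) = n - j, so the two values sum to n + 1. *)
case/andP=> _; case: (unliftP ord0 (s ord0)) => [j -> _|-> /eqP//].
by rewrite lift_perm_lift permE !lift0 /= addnS subnKC.
Qed.

Local Open Scope ring_scope.

Theorem theorem2p7 (R : realFieldType) (k n m : nat) (k_gt1 : (1 < k)%N)
    (n_gt0 : (0 < n)%N) (C_gt0 : (0 < C k n m)%N) :
  expectation (uniform_mass R (perms_with k n m))
      (fun s : 'S_n => (value_at_1 n_gt0 s)%:R)
  = n%:R / 2%:R * (1 - (C k n.-1 m)%:R / (C k n m)%:R) + 1.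
Proof.
case: n n_gt0 C_gt0 => // n n_gt0 C_gt0 /=.
(* The shift by one in [value_at_1], summed over all permutations counted, gives the second summand;
   it becomes the final + 1. *)
have -> : expectation (uniform_mass R (perms_with k n.+1 m))
      (fun s : 'S_n.+1 => (value_at_1 n_gt0 s)%:R)
    = (C k n.+1 m)%:R^-1
      * ((\sum_(s in perms_with k n.+1 m) (s ord0 : nat))%:R
         + (C k n.+1 m)%:R).
  rewrite -natrD {2}/C -sum1_card -big_split /= natr_sum mulr_sumr.
  rewrite /expectation [RHS]big_mkcond; apply: eq_bigr => s _.
  rewrite /uniform_mass; case: ifP => _; last by rewrite mul0r.
  rewrite /value_at_1 addn1; congr (_ * (nat_of_ord (s _)).+1%:R).
  exact: val_inj.
have splitC : (C k n.+1 m)%:R = (C k n m)%:R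
    + #|[set s in perms_with k n.+1 m | s ord0 != ord0]|%:R :> R.
  rewrite -natrD -(card_perms_with_fix0 n m k_gt1); congr _%:R.
  rewrite /C -(cardsID [set s : 'S_n.+1 | s ord0 == ord0]).
  by congr (_ + _)%N; apply: eq_card => s; rewrite !inE // andbC.
have /(congr1 (fun i => i%:R : R)) := sum_perms_with_moved k n m.
rewrite -muln2 !natrM => /(canRL (mulfK _)) -> //; last by rewrite pnatr_eq0.
(* The number of permutations moving 0 is replaced by the difference of the two counts. *)
have /(canRL (addKr _)) -> := esym splitC.
have C_neq0 : (C k n.+1 m)%:R != 0 :> R by rewrite pnatr_eq0 -lt0n.
by field.
Qed.
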